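(* Consider the trust-region $J$-symmetric quasi-Newton algorithm described in the context, applied to the minimax problem $\min_{x\in\mathbb{R}^n}\max_{w\in\mathbb{R}^m}L(x,w)$ with $L$ three times differentiable. Assume: (a) For any $R_0>0$, $F$ and $\nabla F$ are Lipschitz continuous in $S(R_0)$: there exist constants $\gamma_1,\gamma_2$ such that for all $z,z+s\in S(R_0)$, $\|F(z)-F(z+s)\|\le\gamma_1\|s\|$ and $\|\nabla F(z)-\nabla F(z+s)\|\le\gamma_2\|s\|$. (b) There exists at least one $z^*$ with $F(z^* )=0$; furthermore $\nabla F(z^* )$ is invertible for every saddle point $z^*$ (i.e. every $z^*$ with $F(z^* )=0$), and there exists $\gamma$ with $\gamma\ge\|\nabla F(z^* )^{-1}\|$. (c) The sequence of steps $\{s_k\}$ generated by the algorithm is uniformly linearly independent. Then the sequence $g_k=\nabla F(z_k)^TF(z_k)$ generated by the algorithm satisfies $$\lim_{k\to\infty}\|g_k\|=0.$$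
   Context: Notation. $z=(x,w)\in\mathbb{R}^{n+m}$; $F(z)=[\nabla_xL(x,w),-\nabla_wL(x,w)]$; $\nabla F$ is the Jacobian of $F$. $\|\cdot\|$ is the Euclidean/operator norm. $J=\begin{bmatrix} I_{n\times n}&0\\0&-I_{m\times m}\end{bmatrix}$; a matrix $M$ is $J$-symmetric if $M=JM^TJ$. Algorithm. Inputs: $z_0\in\mathbb{R}^{n+m}$; a nonsingular $J$-symmetric $B_0\in\mathbb{R}^{(n+m)\times(n+m)}$; maximal radius $R_0>0$; initial radius $\Delta_0\in(0,R_0]$; $\hat\beta=0.9$; $\zeta\in(0,10^{-3})$. For $k=0,1,2,\ldots$, with $g_k=\nabla F(z_k)^TF(z_k)$ and $$m_k(s)=\tfrac12\|F(z_k)\|^2+g_k^Ts+\tfrac12s^TB_k^TB_ks:$$ 1. Let $p_k^B=-B_k^{-1}(B_k^{-1})^Tg_k$ and $p_k^C=-\min\{\|g_k\|^2/(g_k^TB_k^TB_kg_k),\ \Delta_k/\|g_k\|\}\,g_k$. If $\|p_k^B\|\le\Delta_k$ set $s_k=p_k^B$. Otherwise, if $\|p_k^C\|=\Delta_k$ set $s_k=p_k^C$; and if $\|p_k^C\|<\Delta_k$ set $s_k=p_k^D:=p_k^C+\alpha(p_k^B-p_k^C)$, where $\alpha\in(0,1)$ is the unique value with $\|p_k^C+\alpha(p_k^B-p_k^C)\|=\Delta_k$. 2. Let $\rho_k=\dfrac{\|F(z_k)\|^2/2-\|F(z_k+s_k)\|^2/2}{m_k(0)-m_k(s_k)}$.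 If $\rho_k\le0.5$ set $\Delta_{k+1}=\Delta_k/2$; otherwise set $\Delta_{k+1}=\min\{2\Delta_k,R_0\}$. 3. If $\rho_k\ge\zeta$ set $z_{k+1}=z_k+s_k$ (valid step); otherwise set $z_{k+1}=z_k$ (null step). 4. Let $y_k=F(z_k+s_k)-F(z_k)$ and $$B_{k+1}=B_k+\beta_k\frac{Js_k(y_k-B_ks_k)^TJ+(y_k-B_ks_k)s_k^T}{s_k^Ts_k}-\beta_k^2\frac{(Js_k)^T(y_k-B_ks_k)\,Js_ks_k^T}{(s_k^Ts_k)^2},$$ where $\beta_k$ is drawn uniformly at random from $[1-\hat\beta,1+\hat\beta]$. Given that $B_k$ is nonsingular, $B_{k+1}$ is nonsingular with probability one; the results concern realizations for which every $B_k$ is nonsingular. Level sets. $S=\{z:\|F(z)\|^2/2\le\|F(z_0)\|^2/2\}$ and $S(R_0)=\{z+s:\ \|s\|<R_0,\ z\in S\}$. Uniform linear independence. A sequence of unit vectors $\{u_j\}$ in $\mathbb{R}^{n+m}$ is uniformly linearly independent if there are $\beta>0$, $k_0\ge0$ and $t\ge n+m$ such that for all $k\ge k_0$ and all $\|x\|=1$, $\max\{|\langle x,u_j\rangle|:\ j=k+1,\ldots,k+t\}\ge\beta$. The sequence $\{s_k\}$ is uniformly linearly independent if $s_k\neq0$ for all $k$ and $\{s_k/\|s_k\|\}$ is. *)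

(* Defs.v *)
From HB Require Import structures.
From mathcomp Require Import all_boot all_order all_algebra.
From mathcomp Require Import all_classical all_reals all_analysis.

Set Implicit Arguments.
Unset Strict Implicit.
Unset Printing Implicit Defensive.

Import Order.TTheory GRing.Theory Num.Theory.
Import numFieldNormedType.Exports.

Local Open Scope classical_set_scope.
Local Open Scope ring_scope.

(* The canonical norm `|_| on 'M[R]_(p, q) is the entrywise sup norm: it is
   used only through the topology it induces (differentiability).  All
   quantitative statements use the Euclidean and operator norms below. *)

Definition dot (R : realType) (d : nat) (u v : 'cV[R]_d) : R :=
  (u^T *m v) 0 0.

Definition enorm (R : realType) (d : nat) (u : 'cV[R]_d) : R :=
  Num.sqrt (dot u u).

Definition opnorm (R : realType) (p q : nat) (M : 'M[R]_(p, q)) : R :=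
  sup [set enorm (M *m x) | x in [set x : 'cV[R]_q | enorm x <= 1]].

Definition grad (R : realType) (d : nat) (f : 'cV[R]_d -> R) (x : 'cV[R]_d) :
    'cV[R]_d :=
  \col_(i < d) 'D_(delta_mx i 0) f x.

(* Rows index the components of f and columns the partial derivatives, so
   that 'd f x v = jac f x *m v.  The library's 'J f x is the transposed
   convention, for functions between row vectors. *)
Definition jac (R : realType) (p q : nat) (f : 'cV[R]_q -> 'cV[R]_p)
    (x : 'cV[R]_q) : 'M[R]_(p, q) :=
  \matrix_(i < p, j < q) ('D_(delta_mx j 0) f x) i 0.

(* The first, second and third derivatives exist (in the Frechet sense)
   everywhere; the second derivative is identified with the Hessian matrix. *)
Definition thrice_differentiable (R : realType) (d : nat)
    (f : 'cV[R]_d -> R) : Prop :=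
  [/\ forall x, differentiable f x,
      forall x, differentiable (grad f) x &
      forall x, differentiable (jac (grad f)) x].

Definition joint (R : realType) (n m : nat)
    (L : 'cV[R]_n -> 'cV[R]_m -> R) (z : 'cV[R]_(n + m)) : R :=
  L (usubmx z) (dsubmx z).

Definition minimax_F (R : realType) (n m : nat)
    (L : 'cV[R]_n -> 'cV[R]_m -> R) (z : 'cV[R]_(n + m)) : 'cV[R]_(n + m) :=
  let x := usubmx z in
  let w := dsubmx z in
  col_mx (grad (fun x' => L x' w) x) (- grad (fun w' => L x w') w).

Definition Jmx (R : realType) (n m : nat) : 'M[R]_(n + m) :=
  block_mx 1%:M 0 0 (- 1%:M).

Definition J_symmetric (R : realType) (n m : nat) (M : 'M[R]_(n + m)) : Prop :=
  M = Jmx R n m *m M^T *m Jmx R n m.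

Definition merit_grad (R : realType) (d : nat) (F : 'cV[R]_d -> 'cV[R]_d)
    (z : 'cV[R]_d) : 'cV[R]_d :=
  (jac F z)^T *m F z.

Definition model (R : realType) (d : nat) (F : 'cV[R]_d -> 'cV[R]_d)
    (z : 'cV[R]_d) (B : 'M[R]_d) (s : 'cV[R]_d) : R :=
  enorm (F z) ^+ 2 / 2 + dot (merit_grad F z) s
    + dot s (B^T *m B *m s) / 2.

Definition full_step (R : realType) (d : nat) (B : 'M[R]_d) (g : 'cV[R]_d) :
    'cV[R]_d :=
  - (invmx B *m (invmx B)^T *m g).

Definition cauchy_step (R : realType) (d : nat) (B : 'M[R]_d) (g : 'cV[R]_d)
    (Delta : R) : 'cV[R]_d :=
  - (Num.min (enorm g ^+ 2 / dot g (B^T *m B *m g)) (Delta / enorm g) *: g).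

(* In the last case alpha, hence s, is determined by the two conditions,
   because the norms of pC and pB lie strictly on either side of Delta. *)
Definition dogleg_step (R : realType) (d : nat) (B : 'M[R]_d) (g : 'cV[R]_d)
    (Delta : R) (s : 'cV[R]_d) : Prop :=
  let pB := full_step B g in
  let pC := cauchy_step B g Delta in
  [/\ enorm pB <= Delta -> s = pB,
      Delta < enorm pB -> enorm pC = Delta -> s = pC &
      Delta < enorm pB -> enorm pC < Delta ->
        exists alpha : R, [/\ 0 < alpha < 1,
          enorm (pC + alpha *: (pB - pC)) = Delta &
          s = pC + alpha *: (pB - pC)]].

Definition reduction_ratio (R : realType) (d : nat) (F : 'cV[R]_d -> 'cV[R]_d)
    (z : 'cV[R]_d) (B : 'M[R]_d) (s : 'cV[R]_d) : R :=
  (enorm (F z) ^+ 2 / 2 - enorm (F (z + s)) ^+ 2 / 2)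
    / (model F z B 0 - model F z B s).

Definition J_update (R : realType) (n m : nat) (B : 'M[R]_(n + m))
    (s y : 'cV[R]_(n + m)) (beta : R) : 'M[R]_(n + m) :=
  let J := Jmx R n m in
  let r := y - B *m s in
  B + (beta / dot s s) *: (J *m s *m r^T *m J + r *m s^T)
    - (beta ^+ 2 * dot (J *m s) r / dot s s ^+ 2) *: (J *m s *m s^T).

Definition beta_hat (R : realType) : R := 9 / 10.

(* A realization of the algorithm: beta is the sequence of values taken by the
   random draws, and every B k is required to be nonsingular. *)
Record J_trust_region_run (R : realType) (n m : nat)
    (F : 'cV[R]_(n + m) -> 'cV[R]_(n + m))
    (z0 : 'cV[R]_(n + m)) (B0 : 'M[R]_(n + m)) (R0 Delta0 zeta : R)
    (z s : nat -> 'cV[R]_(n + m)) (B : nat -> 'M[R]_(n + m))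
    (Delta beta : nat -> R) : Prop := {
  run_B0_J_symmetric : J_symmetric B0;
  run_R0_gt0 : 0 < R0;
  run_Delta0 : 0 < Delta0 <= R0;
  run_zeta : 0 < zeta < 10 ^- 3;
  run_init_z : z 0%N = z0;
  run_init_B : B 0%N = B0;
  run_init_Delta : Delta 0%N = Delta0;
  run_B_unit : forall k, B k \in unitmx;
  run_beta : forall k, 1 - beta_hat R <= beta k <= 1 + beta_hat R;
  run_step : forall k,
    dogleg_step (B k) (merit_grad F (z k)) (Delta k) (s k);
  run_radius : forall k,
    Delta k.+1 = if reduction_ratio F (z k) (B k) (s k) <= 1 / 2
                 then Delta k / 2 else Num.min (2 * Delta k) R0;
  run_iterate : forall k,
    z k.+1 = if zeta <= reduction_ratio F (z k) (B k) (s k)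
             then z k + s k else z k;
  run_update : forall k,
    B k.+1 = J_update (B k) (s k) (F (z k + s k) - F (z k)) (beta k)
}.

Definition level_set (R : realType) (d : nat) (F : 'cV[R]_d -> 'cV[R]_d)
    (z0 : 'cV[R]_d) : set 'cV[R]_d :=
  [set z | enorm (F z) ^+ 2 / 2 <= enorm (F z0) ^+ 2 / 2].

Definition enlarged_level_set (R : realType) (d : nat)
    (F : 'cV[R]_d -> 'cV[R]_d) (z0 : 'cV[R]_d) (r : R) : set 'cV[R]_d :=
  [set z + s | z in level_set F z0 & s in [set s : 'cV[R]_d | enorm s < r]].

Definition unif_lin_indep (R : realType) (d : nat) (u : nat -> 'cV[R]_d) :
    Prop :=
  (forall j, enorm (u j) = 1) /\
  exists (b : R) (k0 t : nat), [/\ 0 < b, (d <= t)%N &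
    forall (k : nat) (x : 'cV[R]_d), (k0 <= k)%N -> enorm x = 1 ->
      b <= \big[Num.max/0]_(k.+1 <= j < (k + t).+1) `|dot x (u j)|].

Definition steps_unif_lin_indep (R : realType) (d : nat)
    (s : nat -> 'cV[R]_d) : Prop :=
  (forall k, s k != 0) /\
  unif_lin_indep (fun k => (enorm (s k))^-1 *: s k).

(* Main.v *)
Require Import Defs.
From HB Require Import structures.
From mathcomp Require Import all_boot all_order all_algebra.
From mathcomp Require Import all_classical all_reals all_analysis.
From mathcomp Require Import ring lra.

(** Why the gradients tend to 0.  Two facts carry the proof: the matrices B_k
    stay bounded, and a trust-region method whose model Hessians B_k^T B_k are
    bounded drives its gradient to 0.

    Boundedness.  Put A_k = J B_k, which is symmetric, and let u_k be the unit
    vector along s_k.  The update then reads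
      A_(k+1) = Q_k A_k Q_k + W_k,   Q_k = I - beta_k u_k u_k^T,
    where W_k is bounded by a multiple of |y_k| / |s_k|, hence by the Lipschitz
    constant of F ([J_update_form_le]).  As beta_k lies in [1/10, 19/10], Q_k
    shortens every vector that is not orthogonal to u_k.  Over one window of
    uniform linear independence no direction escapes all the u_k, so the
    product of the Q_k contracts at a uniform rate
    ([relaxed_proj_contraction]).  A bounded perturbation of a uniform
    contraction stays bounded ([form_bounded_uniform]).

    Decrease.  The dogleg step decreases the model at least as much as the
    Cauchy step ([dogleg_step_decrease]), and the model predicts the change of
    |F|^2 / 2 up to O(Delta_k^2) ([model_error_le]), because F is approximated
    by its linearization up to O(|s|^2) on the level set
    ([linearization_error]).  While |g_k| stays above some eps, small radii are
    therefore enlarged, and |F|^2 / 2 would decrease without bound: the lower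
    limit of |g_k| is 0 ([gradient_liminf]).  Accepted steps taken while
    |g_k| >= eps have total length at most a multiple of the decrease of
    |F|^2 / 2.  That decrease tends to 0 along the convergent merit values,
    whereas a passage of the Lipschitz function |g| from 2 eps to below eps
    needs a fixed length; so |g_k| is eventually below 2 eps
    ([gradient_cvg0]). *)

Set Implicit Arguments.
Unset Strict Implicit.
Unset Printing Implicit Defensive.

Import Order.TTheory GRing.Theory Num.Theory.
Import numFieldNormedType.Exports.

Local Open Scope classical_set_scope.
Local Open Scope ring_scope.

(** * Euclidean geometry and the operator norm *)

Section euclidean.
Context {R : realType}.

Lemma dotE d (u v : 'cV[R]_d) : dot u v = \sum_i u i 0 * v i 0.
Proof. by rewrite /dot mxE; apply: eq_bigr => i _; rewrite mxE. Qed.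

Lemma dotC d (u v : 'cV[R]_d) : dot u v = dot v u.
Proof. by rewrite !dotE; apply: eq_bigr => i _; rewrite mulrC. Qed.

Lemma dotDl d (u v w : 'cV[R]_d) : dot (u + v) w = dot u w + dot v w.
Proof. by rewrite /dot linearD mulmxDl mxE. Qed.

Lemma dotDr d (u v w : 'cV[R]_d) : dot w (u + v) = dot w u + dot w v.
Proof. by rewrite !(dotC w) dotDl. Qed.

Lemma dotZl d a (u v : 'cV[R]_d) : dot (a *: u) v = a * dot u v.
Proof. by rewrite /dot linearZ -scalemxAl mxE. Qed.

Lemma dotZr d a (u v : 'cV[R]_d) : dot u (a *: v) = a * dot u v.
Proof. by rewrite !(dotC u) dotZl. Qed.

Lemma dotNl d (u v : 'cV[R]_d) : dot (- u) v = - dot u v.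
Proof. by rewrite -scaleN1r dotZl mulN1r. Qed.

Lemma dotNr d (u v : 'cV[R]_d) : dot u (- v) = - dot u v.
Proof. by rewrite !(dotC u) dotNl. Qed.

Lemma dotBl d (u v w : 'cV[R]_d) : dot (u - v) w = dot u w - dot v w.
Proof. by rewrite dotDl dotNl. Qed.

Lemma dotBr d (u v w : 'cV[R]_d) : dot w (u - v) = dot w u - dot w v.
Proof. by rewrite dotDr dotNr. Qed.

Lemma dot0l d (u : 'cV[R]_d) : dot 0 u = 0.
Proof. by rewrite -(scale0r 0) dotZl mul0r. Qed.

Lemma dot0r d (u : 'cV[R]_d) : dot u 0 = 0.
Proof. by rewrite dotC dot0l. Qed.

Lemma dot_mulmx p q (x : 'cV[R]_p) (M : 'M[R]_(p, q)) y :
  dot x (M *m y) = dot (M^T *m x) y.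
Proof. by rewrite /dot trmx_mul trmxK mulmxA. Qed.

Lemma dot_rank1 d (x a b y : 'cV[R]_d) :
  dot x (a *m b^T *m y) = dot x a * dot b y.
Proof. by rewrite /dot -mulmxA mulmxA mxE big_ord1. Qed.

Lemma dotxx_ge0 d (u : 'cV[R]_d) : 0 <= dot u u.
Proof. by rewrite dotE sumr_ge0 // => i _; rewrite -expr2 sqr_ge0. Qed.

Lemma dotxx_eq0 d (u : 'cV[R]_d) : (dot u u == 0) = (u == 0).
Proof.
apply/idP/eqP => [|->]; last by rewrite dot0l.
rewrite dotE psumr_eq0 => [/allP u0|i _]; last by rewrite -expr2 sqr_ge0.
apply/colP => i; rewrite mxE; apply/eqP.
by have := u0 i (mem_index_enum _); rewrite mulf_eq0 orbb.
Qed.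

Lemma enorm_ge0 d (u : 'cV[R]_d) : 0 <= enorm u.
Proof. exact: sqrtr_ge0. Qed.

Lemma sqr_enorm d (u : 'cV[R]_d) : enorm u ^+ 2 = dot u u.
Proof. by rewrite /enorm sqr_sqrtr // dotxx_ge0. Qed.

Lemma enorm_gt0 d (u : 'cV[R]_d) : (0 < enorm u) = (u != 0).
Proof. by rewrite /enorm sqrtr_gt0 lt_def dotxx_ge0 dotxx_eq0 andbT. Qed.

Lemma enorm0 d : enorm (0 : 'cV[R]_d) = 0.
Proof. by rewrite /enorm dot0l sqrtr0. Qed.

Lemma enormZ d a (u : 'cV[R]_d) : enorm (a *: u) = `|a| * enorm u.
Proof.
by rewrite /enorm dotZl dotZr mulrA -expr2 sqrtrM ?sqr_ge0 // sqrtr_sqr.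
Qed.

Lemma enormN d (u : 'cV[R]_d) : enorm (- u) = enorm u.
Proof. by rewrite -scaleN1r enormZ normrN1 mul1r. Qed.

Lemma enormB d (u v : 'cV[R]_d) : enorm (u - v) = enorm (v - u).
Proof. by rewrite -enormN opprB. Qed.

Lemma cauchy_schwarz d (u v : 'cV[R]_d) : `|dot u v| <= enorm u * enorm v.
Proof.
rewrite -ler_sqr ?nnegrE ?mulr_ge0 ?enorm_ge0 // real_normK ?num_real //.
rewrite exprMn !sqr_enorm.
have [->|v0] := eqVneq v 0; first by rewrite !dot0r expr0n mulr0.
have vv : 0 < dot v v by rewrite lt_def dotxx_ge0 dotxx_eq0 v0.
have := dotxx_ge0 (dot v v *: u - dot u v *: v).
rewrite !(dotBl, dotBr, dotZl, dotZr) (dotC v u).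
rewrite [leRHS](_ : _ = dot v v * (dot u u * dot v v - dot u v ^+ 2));
  last by ring.
by rewrite pmulr_rge0 // subr_ge0.
Qed.

Lemma dot_le d (u v : 'cV[R]_d) : dot u v <= enorm u * enorm v.
Proof. exact: le_trans (ler_norm _) (cauchy_schwarz _ _). Qed.

Lemma ler_enormD d (u v : 'cV[R]_d) : enorm (u + v) <= enorm u + enorm v.
Proof.
rewrite -ler_sqr ?nnegrE ?addr_ge0 ?enorm_ge0 //.
rewrite sqrrD !sqr_enorm !(dotDl, dotDr) (dotC v u).
have := dot_le u v; lra.
Qed.

Lemma ler_enormB d (u v : 'cV[R]_d) : enorm (u - v) <= enorm u + enorm v.
Proof. by rewrite -(enormN v) ler_enormD. Qed.

(** Some bound is needed before [opnorm] can be used at all: the supremum that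
    defines it has no meaning for an unbounded set. *)
Lemma enorm_mulmx_bound p q (M : 'M[R]_(p, q)) :
  exists2 c, 0 <= c & forall x, enorm (M *m x) <= c * enorm x.
Proof.
pose c2 := \sum_i enorm (row i M)^T ^+ 2.
have c2_ge0 : 0 <= c2 by rewrite sumr_ge0 // => i _; rewrite sqr_ge0.
exists (Num.sqrt c2) => [|x]; first exact: sqrtr_ge0.
rewrite -ler_sqr ?nnegrE ?mulr_ge0 ?enorm_ge0 ?sqrtr_ge0 //.
rewrite exprMn (sqr_sqrtr c2_ge0) sqr_enorm dotE mulr_suml ler_sum // => i _.
have -> : (M *m x) i 0 = dot (row i M)^T x.
  by rewrite dotE mxE; apply: eq_bigr => j _; rewrite !mxE.
rewrite -expr2 -exprMn -real_normK ?num_real //.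
by rewrite ler_sqr ?nnegrE ?mulr_ge0 ?enorm_ge0 // cauchy_schwarz.
Qed.

Lemma enorm_mulmx_le p q (M : 'M[R]_(p, q)) x :
  enorm (M *m x) <= opnorm M * enorm x.
Proof.
have [->|x0] := eqVneq x 0; first by rewrite mulmx0 !enorm0 mulr0.
have x_gt0 : 0 < enorm x by rewrite enorm_gt0.
rewrite -ler_pdivrMr //.
have -> : enorm (M *m x) / enorm x = enorm (M *m ((enorm x)^-1 *: x)).
  by rewrite -scalemxAr enormZ ger0_norm ?invr_ge0 ?enorm_ge0 // mulrC.
apply: sup_upper_bound.
  split.
    by exists (enorm (M *m 0)), 0 => //=; rewrite enorm0 ler01.
  have [c c0 Mc] := enorm_mulmx_bound M.
  exists c => _ [y /= y1 <-]; apply: le_trans (Mc y) _.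
  by rewrite -[leRHS]mulr1 ler_wpM2l.
exists ((enorm x)^-1 *: x) => //=.
by rewrite enormZ ger0_norm ?invr_ge0 ?enorm_ge0 // mulVf ?gt_eqF.
Qed.

End euclidean.

(** * Relaxed projections along unit vectors *)

(** For a unit vector u and beta = 1 this is the orthogonal projection onto the
    hyperplane orthogonal to u; in general it multiplies the component along u
    by 1 - beta. *)
Definition relaxed_proj {R : realType} d (beta : R) (u x : 'cV[R]_d) :
    'cV[R]_d :=
  x - (beta * dot u x) *: u.

Section relaxed_projection.
Context {R : realType}.

Lemma sqr_enorm_relaxed_proj d (beta : R) (u x : 'cV[R]_d) : enorm u = 1 ->
  enorm (relaxed_proj beta u x) ^+ 2
    = enorm x ^+ 2 - beta * (2 - beta) * dot u x ^+ 2.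
Proof.
move=> u1; have uu : dot u u = 1 by rewrite -sqr_enorm u1 expr1n.
rewrite !sqr_enorm /relaxed_proj !(dotBl, dotBr, dotZl, dotZr) uu (dotC x u).
ring.
Qed.

(** The constant 19/100 is the least value of beta * (2 - beta) on
    [1/10, 19/10]. *)
Lemma sqr_enorm_relaxed_proj_le d (beta : R) (u x : 'cV[R]_d) :
  enorm u = 1 -> 1 / 10 <= beta <= 19 / 10 ->
  enorm (relaxed_proj beta u x) ^+ 2 <= enorm x ^+ 2 - 19 / 100 * dot u x ^+ 2.
Proof.
move=> u1 /andP[b1 b2]; rewrite sqr_enorm_relaxed_proj // lerD2l lerN2.
by rewrite ler_wpM2r ?sqr_ge0 //; nra.
Qed.

Lemma enorm_relaxed_proj_le d (beta : R) (u x : 'cV[R]_d) :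
  enorm u = 1 -> 1 / 10 <= beta <= 19 / 10 ->
  enorm (relaxed_proj beta u x) <= enorm x.
Proof.
move=> u1 hb; rewrite -ler_sqr ?nnegrE ?enorm_ge0 //.
apply: le_trans (sqr_enorm_relaxed_proj_le x u1 hb) _.
by have := sqr_ge0 (dot u x); lra.
Qed.

Lemma relaxed_proj_displacement d (beta : R) (u x : 'cV[R]_d) :
  enorm u = 1 -> 1 / 10 <= beta <= 19 / 10 ->
  enorm (relaxed_proj beta u x - x) <= 19 / 10 * `|dot u x|.
Proof.
move=> u1 /andP[b1 b2]; rewrite /relaxed_proj addrAC subrr add0r enormN enormZ.
rewrite u1 mulr1 normrM ler_wpM2r // ger0_norm //; lra.
Qed.

(** A start vector seen by one direction of the window must lose a fixed share
    of its length.  Either some factor shortens it noticeably, or all the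
    factors move it so little that the direction of index i0 still meets almost
    the same vector, and then that factor shortens it. *)
Lemma relaxed_proj_contraction d t (b : R) (beta : nat -> R)
    (u v : nat -> 'cV[R]_d) (i0 : nat) :
  0 <= b -> (i0 < t)%N ->
  (forall i, enorm (u i) = 1) -> (forall i, 1 / 10 <= beta i <= 19 / 10) ->
  (forall i, v i.+1 = relaxed_proj (beta i) (u i) (v i)) ->
  b * enorm (v 0%N) <= `|dot (u i0) (v 0%N)| ->
  enorm (v t) ^+ 2
    <= (1 - 19 / 100 * (b / (2 * t%:R)) ^+ 2) * enorm (v 0%N) ^+ 2.
Proof.
move=> b0 i0t u1 hb vS hi0.
have t0 : (0 : R) < t%:R by rewrite ltr0n (leq_ltn_trans _ i0t).
set eta := b / (2 * t%:R).
have mono i j : (i <= j)%N -> enorm (v j) <= enorm (v i).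
  elim: j => [|j IH]; first by rewrite leqn0 => /eqP ->.
  rewrite leq_eqVlt => /predU1P[-> //|]; rewrite ltnS => /IH ih.
  by apply: le_trans ih; rewrite vS; exact: enorm_relaxed_proj_le.
(* If all the inner products were below eta * |v 0|, the drift before index i0
   would be at most 19/10 * i0 * eta * |v 0|, too little to hide the component
   b * |v 0| = 2 * t * eta * |v 0| along u i0. *)
have [i it hi] : exists2 i, (i < t)%N &
    eta * enorm (v 0%N) <= `|dot (u i) (v i)|.
  apply: contrapT => /forall2NP small.
  have {}small i : (i < t)%N -> `|dot (u i) (v i)| < eta * enorm (v 0%N).
    by move=> it; rewrite ltNge; apply/negP; have [] := small i.
  have drift i : (i < t)%N ->
      enorm (v i - v 0%N) <= 19 / 10 * (i%:R * (eta * enorm (v 0%N))).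
    elim: i => [_|i IH it]; first by rewrite subrr enorm0 mul0r mulr0.
    have {}IH := IH (ltnW it).
    rewrite -(subrKA (v i)); apply: le_trans (ler_enormD _ _) _.
    have := relaxed_proj_displacement (v i) (u1 i) (hb i); rewrite -vS.
    by have := small i (ltnW it); rewrite -natr1; lra.
  have := small _ i0t; rewrite ltNge => /negP; apply.
  have ub : `|dot (u i0) (v 0%N)|
      <= `|dot (u i0) (v i0)| + enorm (v i0 - v 0%N).
    have -> : dot (u i0) (v 0%N)
        = dot (u i0) (v i0) - dot (u i0) (v i0 - v 0%N).
      by rewrite dotBr; ring.
    apply: le_trans (ler_normB _ _) _; rewrite lerD2l.
    by apply: le_trans (cauchy_schwarz _ _) _; rewrite u1 mul1r.
  have := drift _ i0t.
  have e0 : 0 <= eta * enorm (v 0%N).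
    by rewrite mulr_ge0 ?enorm_ge0 // divr_ge0 // mulr_ge0 // ltW.
  have bE : b * enorm (v 0%N) = 2 * (t%:R * (eta * enorm (v 0%N))).
    by rewrite /eta; field; rewrite gt_eqF.
  have i0t' : i0%:R * (eta * enorm (v 0%N)) + eta * enorm (v 0%N)
      <= t%:R * (eta * enorm (v 0%N)).
    by rewrite -[X in _ + X]mul1r -mulrDl ler_wpM2r // natr1 ler_nat.
  move: hi0; rewrite bE.
  have : 0 <= i0%:R * (eta * enorm (v 0%N)) by rewrite mulr_ge0.
  lra.
have : enorm (v t) ^+ 2 <= enorm (v i.+1) ^+ 2.
  by rewrite ler_sqr ?nnegrE ?enorm_ge0 // mono.
move=> /le_trans; apply; rewrite vS.
apply: le_trans (sqr_enorm_relaxed_proj_le _ (u1 i) (hb i)) _.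
have : enorm (v i) ^+ 2 <= enorm (v 0%N) ^+ 2.
  by rewrite ler_sqr ?nnegrE ?enorm_ge0 // mono.
have : (eta * enorm (v 0%N)) ^+ 2 <= dot (u i) (v i) ^+ 2.
  rewrite -[leRHS]real_normK ?num_real // ler_sqr ?nnegrE //.
  by rewrite mulr_ge0 ?enorm_ge0 // divr_ge0 // mulr_ge0 // ltW.
rewrite exprMn; lra.
Qed.

End relaxed_projection.

(** * Bounded perturbations of a uniform contraction *)

(** Bilinear forms suit the recurrence A_(k+1) = Q_k A_k Q_k + W_k: unrolling it
    just moves the factors Q_k onto the two arguments. *)
Definition form_bounded {R : realType} d (A : 'M[R]_d) (a : R) :=
  forall x y, `|dot x (A *m y)| <= a * (enorm x * enorm y).

Fixpoint unroll {R : realType} d (beta : nat -> R) (u : nat -> 'cV[R]_d)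
    (x : 'cV[R]_d) i :=
  if i is i'.+1 then relaxed_proj (beta i') (u i') (unroll beta u x i') else x.

Section bounded.
Context {R : realType}.

Lemma form_bounded_le d (A : 'M[R]_d) a a' :
  a <= a' -> form_bounded A a -> form_bounded A a'.
Proof.
move=> aa' Aa x y; apply: le_trans (Aa x y) _.
by rewrite ler_wpM2r // mulr_ge0 ?enorm_ge0.
Qed.

Lemma form_bounded_enorm_le d (A : 'M[R]_d) a x :
  form_bounded A a -> enorm (A *m x) <= a * enorm x.
Proof.
move=> Aa; have [Ax0|] := eqVneq (A *m x) 0.
  have [->|x0] := eqVneq x 0; first by rewrite mulmx0 !enorm0 mulr0.
  have := Aa x x; rewrite Ax0 dot0r normr0 enorm0 mulrA pmulr_lge0 //.
  by rewrite enorm_gt0.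
rewrite -enorm_gt0 => Ax0; rewrite -(ler_pM2l Ax0) -expr2 sqr_enorm.
by apply: le_trans (ler_norm _) (le_trans (Aa _ _) _); rewrite mulrCA.
Qed.

Lemma form_bounded_exists d (A : 'M[R]_d) :
  exists2 a, 0 <= a & form_bounded A a.
Proof.
have [c c0 Ac] := enorm_mulmx_bound A; exists c => // x y.
apply: le_trans (cauchy_schwarz _ _) _; rewrite mulrCA ler_wpM2l ?enorm_ge0 //.
Qed.

Variables (d : nat) (A : nat -> 'M[R]_d) (u : nat -> 'cV[R]_d)
  (beta : nat -> R) (c : R).
Hypothesis c0 : 0 <= c.
Hypothesis beta_itv : forall k, 1 / 10 <= beta k <= 19 / 10.
Hypothesis u_unit : forall k, enorm (u k) = 1.
Hypothesis A_step : forall k x y,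
  `|dot x (A k.+1 *m y)|
    <= `|dot (relaxed_proj (beta k) (u k) x)
             (A k *m relaxed_proj (beta k) (u k) y)| + c * (enorm x * enorm y).

Lemma form_bounded_step k a :
  0 <= a -> form_bounded (A k) a -> form_bounded (A k.+1) (a + c).
Proof.
move=> a0 Aa x y; apply: le_trans (A_step _ _ _) _; rewrite mulrDl lerD2r.
apply: le_trans (Aa _ _) _; rewrite ler_wpM2l //.
by rewrite ler_pM ?enorm_ge0 // enorm_relaxed_proj_le.
Qed.

Lemma form_bounded_linear a k :
  0 <= a -> form_bounded (A 0%N) a -> form_bounded (A k) (a + k%:R * c).
Proof.
move=> a0 Aa; elim: k => [|k IH]; first by rewrite mul0r addr0.
rewrite -natr1 mulrDl mul1r addrA; apply: form_bounded_step => //.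
by rewrite addr_ge0 // mulr_ge0.
Qed.

(** Unrolling goes backwards in time: the last update acts first on the
    arguments, hence the reversed indices k - l - 1. *)
Lemma form_unroll k i x y
    (v := unroll (fun l => beta (k - l.+1)%N) (fun l => u (k - l.+1)%N)) :
  (i <= k)%N ->
  `|dot x (A k *m y)| <= `|dot (v x i) (A (k - i)%N *m v y i)|
     + i%:R * c * (enorm x * enorm y).
Proof.
move=> ik; have vle z j : enorm (v z j) <= enorm z.
  by elim: j => [|j IH] //=; apply: le_trans IH; exact: enorm_relaxed_proj_le.
elim: i ik => [_|i IH ik]; first by rewrite !mul0r addr0 subn0.
apply: le_trans (IH (ltnW ik)) _.
have -> : (k - i)%N = (k - i.+1).+1 by rewrite subnSK.
have := A_step (k - i.+1) (v x i) (v y i).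
have : c * (enorm (v x i) * enorm (v y i)) <= c * (enorm x * enorm y).
  by rewrite ler_wpM2l // ler_pM ?enorm_ge0.
rewrite -natr1 !mulrDl mul1r /=; lra.
Qed.

Variables (b : R) (k0 t : nat).
Hypothesis b01 : 0 < b <= 1.
Hypothesis t0 : (0 < t)%N.
Hypothesis uli : forall (k : nat) (x : 'cV[R]_d), (k0 <= k)%N ->
  exists2 j, (k < j <= k + t)%N & b * enorm x <= `|dot (u j) x|.

(** Both arguments are contracted in square norm by the same factor, so the form
    is contracted by that factor once. *)
Lemma form_window k a : 0 <= a -> (k0 <= k)%N -> form_bounded (A k.+1) a ->
  form_bounded (A (k + t).+1)
    ((1 - 19 / 100 * (b / (2 * t%:R)) ^+ 2) * a + t%:R * c).
Proof.
move=> a0 kk0 Aa x y; set th := 1 - _.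
have tR : (1 : R) <= t%:R by rewrite ler1n.
have bt : 0 <= b / (2 * t%:R) <= 1 / 2.
  case/andP: b01 => b_gt0 b_le1.
  rewrite divr_ge0 ?(ltW b_gt0) ?mulr_ge0 ?ler0n //=.
  by rewrite ler_pdivrMr ?mulr_gt0 ?ltr0n //; lra.
have th0 : 0 <= th by rewrite /th; nra.
set v := unroll (fun l => beta ((k + t).+1 - l.+1)%N)
                (fun l => u ((k + t).+1 - l.+1)%N).
have vt z : enorm (v z t) ^+ 2 <= th * enorm z ^+ 2.
  have [j /andP[kj jt] hj] := uli z kk0.
  pose i0 := (k + t - j)%N.
  have i0t : (i0 < t)%N.
    by rewrite /i0 ltn_subLR // [(j + t)%N]addnC [(k + t)%N]addnC ltn_add2l.
  apply: (@relaxed_proj_contraction R d t b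
    (fun l => beta ((k + t).+1 - l.+1)%N) (fun l => u ((k + t).+1 - l.+1)%N)
    (v z) i0) => //.
    by case/andP: b01 => /ltW.
  by rewrite subSS /i0 subKn.
have tk : (t <= (k + t).+1)%N by rewrite ltnW // ltnS leq_addl.
apply: le_trans (form_unroll x y tk) _.
have -> : ((k + t).+1 - t)%N = k.+1 by rewrite -addSn addnK.
rewrite mulrDl lerD2r; apply: le_trans (Aa _ _) _.
rewrite [th * a]mulrC -[leRHS]mulrA ler_wpM2l //.
rewrite -ler_sqr ?nnegrE ?mulr_ge0 ?enorm_ge0 //.
rewrite !exprMn; apply: le_trans (ler_pM _ _ (vt x) (vt y)) _.
- exact: sqr_ge0.
- exact: sqr_ge0.
- by rewrite mulrACA.
Qed.

(** Windows of length t that start after k0 send a bound a to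
    (1 - q) * a + t * c; the indices before the first full window are covered by
    linear growth. *)
Lemma form_bounded_uniform : exists2 a, 0 <= a & forall k, form_bounded (A k) a.
Proof.
have [a0 a0_ge0 A0] := form_bounded_exists (A 0%N).
pose q := 19 / 100 * (b / (2 * t%:R)) ^+ 2.
have q0 : 0 < q.
  case/andP: b01 => b_gt0 _.
  by rewrite mulr_gt0 ?exprn_gt0 ?divr_gt0 ?mulr_gt0 ?ltr0n //.
(* The map a |-> (1 - q) * a + t * c does not increase any a >= t * c / q. *)
pose a := a0 + (k0 + t).+1%:R * c + t%:R * c / q.
have tcq : 0 <= t%:R * c / q by rewrite divr_ge0 ?(ltW q0) // mulr_ge0.
have kc : 0 <= (k0 + t).+1%:R * c by rewrite mulr_ge0.
exists a; first by rewrite /a; lra.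
have a_ge0 : 0 <= a by rewrite /a; lra.
elim/ltn_ind => k IH.
have [kle|klt] := leqP k (k0 + t).+1.
  apply: form_bounded_le (form_bounded_linear k a0_ge0 A0).
  rewrite /a -addrA lerD2l; apply: ler_wpDr => //.
  by rewrite ler_wpM2r // ler_nat.
have kE : k = ((k - t.+1) + t).+1.
  by rewrite -addnS subnK // (leq_trans _ klt) // ltnS leqW // leq_addl.
have kt : (k - t.+1).+1 = (k - t)%N by rewrite subnSK // kE ltnS leq_addl.
rewrite kE; apply: form_bounded_le (form_window a_ge0 _ _).
- rewrite -/q mulrBl mul1r -addrA gerDl addrC subr_le0.
  rewrite -ler_pdivrMl // mulrC.
  by rewrite /a; lra.
- rewrite leq_subRL ?addSn ?(addnC t) ?(ltnW klt) // (leq_trans _ klt) //.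
  by rewrite ltnS leqW // leq_addl.
- rewrite kt; apply: IH.
  by rewrite ltn_subrL t0 /= (leq_ltn_trans _ klt).
Qed.

End bounded.

(** * The J-symmetric update as a contraction plus a bounded term *)

Section J_update.
Context {R : realType} {n m : nat}.
Local Notation J := (Jmx R n m).

Lemma trmx_Jmx : J^T = J.
Proof. by rewrite /Jmx tr_block_mx linearN !trmx0 /= !trmx1. Qed.

Lemma mul_Jmx_Jmx : J *m J = 1%:M.
Proof.
rewrite /Jmx mulmx_block !mulmx0 !mul0mx !addr0 add0r mulmx1 mulNmx mulmxN.
by rewrite mulmx1 opprK -scalar_mx_block.
Qed.

Lemma enorm_Jmx (x : 'cV[R]_(n + m)) : enorm (J *m x) = enorm x.
Proof.
by rewrite /enorm dot_mulmx mulmxA trmx_Jmx mul_Jmx_Jmx mul1mx.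
Qed.

Lemma J_symmetricP (M : 'M[R]_(n + m)) :
  J_symmetric M <-> (J *m M)^T = J *m M.
Proof.
rewrite /J_symmetric trmx_mul trmx_Jmx; split=> [{2}->|ME].
  by rewrite !mulmxA mul_Jmx_Jmx mul1mx.
by rewrite -mulmxA ME mulmxA mul_Jmx_Jmx mul1mx.
Qed.

(** Multiplication by J turns the J-symmetric update into the relaxed form of
    the Powell symmetric Broyden update. *)
Lemma mul_Jmx_update (B : 'M[R]_(n + m)) s y beta (A := J *m B)
    (r := J *m y - A *m s) :
  J *m J_update B s y beta
    = A + (beta / dot s s) *: (s *m r^T + r *m s^T)
      - (beta ^+ 2 * dot s r / dot s s ^+ 2) *: (s *m s^T).
Proof.
have rE : r = J *m (y - B *m s) by rewrite mulmxBr mulmxA.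
rewrite /J_update mulmxBr mulmxDr -!scalemxAr mulmxDr !mulmxA.
rewrite mul_Jmx_Jmx mul1mx.
have -> : dot (J *m s) (y - B *m s) = dot s r.
  by rewrite rE [RHS]dot_mulmx trmx_Jmx.
by rewrite rE trmx_mul trmx_Jmx !mulmxA.
Qed.

Lemma mul_Jmx_update_sym (B : 'M[R]_(n + m)) s y beta :
  (J *m B)^T = J *m B ->
  (J *m J_update B s y beta)^T = J *m J_update B s y beta.
Proof.
rewrite mul_Jmx_update; move: (J *m B) => A symA; move: (J *m y - A *m s) => r.
rewrite linearB linearD linearZ linearD linearZ /= symA !trmx_mul !trmxK.
by rewrite [in LHS](addrC (r *m _)).
Qed.

(** Since A is symmetric, the terms of the update that contain A s are exactly
    those of the expansion of Q A Q; what remains contains y only. *)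
Lemma J_update_form (B : 'M[R]_(n + m)) s y beta x w (A := J *m B)
    (u := (enorm s)^-1 *: s) (e := (enorm s)^-1 *: (J *m y)) :
  s != 0 -> A^T = A ->
  dot x (J *m J_update B s y beta *m w)
    = dot (relaxed_proj beta u x) (A *m relaxed_proj beta u w)
      + beta * (dot u x * dot e w + dot e x * dot u w)
      - beta ^+ 2 * dot u e * (dot u x * dot u w).
Proof.
move=> s0 symA; have sg0 : enorm s != 0 by rewrite gt_eqF // enorm_gt0.
set sg := enorm s in sg0.
have sE : s = sg *: u by rewrite scalerA mulfV // scale1r.
have yE : J *m y = sg *: e by rewrite scalerA mulfV // scale1r.
have uu : dot u u = 1.
  by rewrite dotZl dotZr -sqr_enorm -/sg; field.
have ss : dot s s = sg ^+ 2 by rewrite -sqr_enorm.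
clearbody u e sg.
have rank2 c1 c2 (a q : 'cV[R]_(n + m)) :
    dot x ((A + c1 *: (a *m q^T + q *m a^T) - c2 *: (a *m a^T)) *m w)
    = dot x (A *m w) + c1 * (dot x a * dot q w + dot x q * dot a w)
      - c2 * (dot x a * dot a w).
  rewrite mulmxBl mulmxDl -!scalemxAl mulmxDl.
  by rewrite !(dotDr, dotNr, dotZr) !dot_rank1.
have rE : J *m y - A *m s = sg *: (e - A *m u).
  by rewrite yE sE -scalemxAr scalerBr.
rewrite mul_Jmx_update rank2 rE ss.
have sx : dot x s = sg * dot u x by rewrite sE dotZr dotC.
have sw : dot s w = sg * dot u w by rewrite sE dotZl.
have sq q : dot s q = sg * dot u q by rewrite sE dotZl.
rewrite sx sw sq /relaxed_proj mulmxBr -scalemxAr.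
rewrite !(dotBl, dotBr, dotZl, dotZr).
have -> : dot (A *m u) w = dot u (A *m w) by rewrite dot_mulmx symA.
rewrite (dotC x e); field.
exact: sg0.
Qed.

(** The remainder is at most (2 * 19/10 + (19/10)^2) * g * |x| * |w|, and this
    constant is below 8. *)
Lemma J_update_form_le (B : 'M[R]_(n + m)) s y beta g x w
    (u := (enorm s)^-1 *: s) :
  s != 0 -> (J *m B)^T = J *m B -> 1 / 10 <= beta <= 19 / 10 ->
  enorm y <= g * enorm s ->
  `|dot x (J *m J_update B s y beta *m w)|
    <= `|dot (relaxed_proj beta u x) (J *m B *m relaxed_proj beta u w)|
       + 8 * g * (enorm x * enorm w).
Proof.
move=> s0 symA /andP[b1 b2] yg; rewrite J_update_form // -/u.
set e := (enorm s)^-1 *: (J *m y).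
have sg0 : 0 < enorm s by rewrite enorm_gt0.
have u1 : enorm u = 1.
  by rewrite enormZ ger0_norm ?invr_ge0 ?enorm_ge0 // mulVf ?gt_eqF.
have eg : enorm e <= g.
  rewrite enormZ ger0_norm ?invr_ge0 ?enorm_ge0 // enorm_Jmx.
  by rewrite ler_pdivrMl // mulrC.
have g0 : 0 <= g := le_trans (enorm_ge0 _) eg.
have hu z : `|dot u z| <= enorm z.
  by have := cauchy_schwarz u z; rewrite u1 mul1r.
have he z : `|dot e z| <= g * enorm z.
  by apply: le_trans (cauchy_schwarz _ _) _; rewrite ler_wpM2r ?enorm_ge0.
have N0 : 0 <= g * (enorm x * enorm w) by rewrite !mulr_ge0 ?enorm_ge0.
have h1 : `|dot u x * dot e w| <= g * (enorm x * enorm w).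
  by rewrite normrM mulrCA ler_pM.
have h2 : `|dot e x * dot u w| <= g * (enorm x * enorm w).
  by rewrite normrM mulrA ler_pM.
have h3 : `|dot u e * (dot u x * dot u w)| <= g * (enorm x * enorm w).
  by rewrite !normrM ler_pM ?mulr_ge0 ?ler_pM // (le_trans (hu e)).
have h4 : `|beta * (dot u x * dot e w + dot e x * dot u w)|
    <= 38 / 10 * (g * (enorm x * enorm w)).
  have -> : 38 / 10 * (g * (enorm x * enorm w))
      = 19 / 10 * (2 * (g * (enorm x * enorm w))) by field.
  rewrite normrM ger0_norm; last lra.
  have := ler_normD (dot u x * dot e w) (dot e x * dot u w) => h.
  by rewrite ler_pM //; lra.
have h5 : `|beta ^+ 2 * dot u e * (dot u x * dot u w)|
    <= 361 / 100 * (g * (enorm x * enorm w)).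
  by rewrite -mulrA normrM ger0_norm ?sqr_ge0 // ler_pM ?sqr_ge0 //; nra.
set P := dot (relaxed_proj _ _ _) _.
apply: le_trans (ler_normB _ _) _; apply: le_trans (lerD (ler_normD _ _) h5) _.
lra.
Qed.

End J_update.

(** * Differentiability of the minimax operator and linearization *)

Section taylor.
Context {R : realType}.

Lemma col_delta_sum d (v : 'cV[R]_d) : v = \sum_i v i 0 *: delta_mx i 0.
Proof.
by rewrite [LHS]matrix_sum_delta; apply: eq_bigr => i _; rewrite big_ord1.
Qed.

Lemma differentiable_col (V : normedModType R) d (F : V -> 'cV[R]_d) x :
  (forall i, differentiable (fun z => F z i 0) x) -> differentiable F x.
Proof.
move=> dF; have -> : F = \sum_i (fun z => F z i 0 *: delta_mx i 0).
  by apply/funext => z; rewrite fct_sumE -col_delta_sum.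
by apply: differentiable_sum => i; exact: differentiableZl.
Qed.

Lemma jac_mulmx p q (f : 'cV[R]_q -> 'cV[R]_p) x v :
  differentiable f x -> jac f x *m v = 'd f x v.
Proof.
move=> df; rewrite [in RHS](col_delta_sum v) linear_sum /=.
apply/colP => i; rewrite mxE summxE; apply: eq_bigr => j _.
by rewrite !mxE linearZ mxE mulrC deriveE.
Qed.

Lemma eq_derive_line (U V W : normedModType R) (f : U -> W) (g : V -> W)
    a b v w :
  (forall h : R, f (h *: v + a) = g (h *: w + b)) -> 'D_v f a = 'D_w g b.
Proof.
move=> fg; rewrite /derive; set p := fun _ => _; set q := fun _ => _.
suff -> : p = q by [].
apply/funext => h; rewrite /p /q /= fg.
by have := fg 0; rewrite !scale0r !add0r => ->.
Qed.

(** The partial gradients of L are the two blocks of the gradient of the joint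
    function, so F inherits its differentiability from that gradient. *)
Lemma minimax_F_grad n m (L : 'cV[R]_n -> 'cV[R]_m -> R) z :
  minimax_F L z = Jmx R n m *m grad (joint L) z.
Proof.
rewrite -[grad (joint L) z]vsubmxK /Jmx mul_block_col !mul0mx mul1mx addr0.
rewrite add0r mulNmx mul1mx /minimax_F; congr (col_mx _ (- _)).
  apply/colP => i; rewrite !mxE.
  apply: eq_derive_line => h; rewrite /joint !linearD !linearZ /=.
  have -> : usubmx (delta_mx (lshift m i) 0) = delta_mx i 0 :> 'cV[R]_n.
    by apply/colP => k; rewrite !mxE (inj_eq (@lshift_inj _ _)).
  have -> : dsubmx (delta_mx (lshift m i) 0) = 0 :> 'cV[R]_m.
    by apply/colP => k; rewrite !mxE eq_rlshift.
  by rewrite scaler0 add0r.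
apply/colP => i; rewrite !mxE.
apply: eq_derive_line => h; rewrite /joint !linearD !linearZ /=.
have -> : dsubmx (delta_mx (rshift n i) 0) = delta_mx i 0 :> 'cV[R]_m.
  by apply/colP => k; rewrite !mxE (inj_eq (@rshift_inj _ _)).
have -> : usubmx (delta_mx (rshift n i) 0) = 0 :> 'cV[R]_n.
  by apply/colP => k; rewrite !mxE eq_lrshift.
by rewrite scaler0 add0r.
Qed.

Lemma differentiable_mulmx d e (V : normedModType R) (M : 'M[R]_(e, d))
    (G : V -> 'cV[R]_d) x :
  differentiable G x -> differentiable (fun z => M *m G z) x.
Proof.
move=> dG; apply: differentiable_col => i.
have -> : (fun z => (M *m G z) i 0) = \sum_j (fun z => M i j *: G z j 0).
  by apply/funext => z; rewrite fct_sumE mxE.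
apply: differentiable_sum => j; apply: differentiableZ.
exact: (differentiable_comp dG (differentiable_coord _ _ _)).
Qed.

Lemma is_derive_dot_line d (F : 'cV[R]_d -> 'cV[R]_d) w z s t :
  differentiable F (z + t *: s) ->
  is_derive t 1 (fun a => dot w (F (z + a *: s)))
    (dot w (jac F (z + t *: s) *m s)).
Proof.
move=> dF.
have dl : is_diff t (fun a : R => z + a *: s) (fun a : R => a *: s).
  have -> : (fun a : R => z + a *: s) = cst z + ( *:%R ^~ s) by [].
  exact: is_diff_eq (is_diffD (is_diff_cst z t) (is_diff_scalel t s)) (add0r _).
have dFl : is_diff t (fun a : R => F (z + a *: s))
    (fun a => 'd F (z + t *: s) (a *: s)).
  have dFt := differentiableP dF.
  exact: (is_diff_comp dl dFt).
have drv : derivable (fun a : R => F (z + a *: s)) t 1.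
  by apply: diff_derivable; exact: ex_diff.
have coord i : is_derive t 1 (fun a => F (z + a *: s) i 0)
    ((jac F (z + t *: s) *m s) i 0).
  apply: DeriveDef; first by have /derivable_mxP := drv; exact.
  have := derive_mx drv => /(congr1 (fun M : 'cV[R]_d => M i 0)).
  rewrite mxE => <-; rewrite deriveE; last exact: ex_diff.
  by rewrite diff_val jac_mulmx // scale1r.
have -> : (fun a => dot w (F (z + a *: s)))
    = \sum_i (w i 0 *: (fun a => F (z + a *: s) i 0 : R)).
  by apply/funext => a; rewrite dotE fct_sumE.
by rewrite dotE; apply: is_derive_sum.
Qed.

(** The mean value theorem is scalar; it is applied to the component of F along
    the error vector e itself, which makes the error appear as dot e e. *)
Lemma taylor_first_order d (F : 'cV[R]_d -> 'cV[R]_d) (z s : 'cV[R]_d)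
    (c : R) :
  (forall y, differentiable F y) -> 0 <= c ->
  (forall t : R, 0 <= t <= 1 -> forall x,
     enorm ((jac F (z + t *: s) - jac F z) *m x) <= c * enorm x) ->
  enorm (F (z + s) - F z - jac F z *m s) <= c * enorm s.
Proof.
move=> dF c0 jacL; set e := F (z + s) - F z - jac F z *m s.
pose h (t : R) : R := dot e (F (z + t *: s)) - t * dot e (jac F z *m s).
pose h' (t : R) : R := dot e (jac F (z + t *: s) *m s) - dot e (jac F z *m s).
have dh (t : R) : is_derive t 1 h (h' t).
  have d1 := is_derive_dot_line e (dF (z + t *: s)).
  have -> : h = (fun a => dot e (F (z + a *: s)))
      - (dot e (jac F z *m s) *: (@id R)).
    by apply/funext => a; rewrite /h mulrC.
  by apply: is_derive_eq; rewrite scaler1.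
have [|t t01] := @MVT R h h' 0 1 ltr01 (fun t _ => dh t).
  apply: continuous_subspaceT => t; apply: differentiable_continuous.
  by apply/derivable1_diffP; exact: ex_derive.
rewrite subr0 mulr1 /h scale1r scale0r addr0 mul0r mul1r subr0 => hE.
have eE : dot e e = dot e ((jac F (z + t *: s) - jac F z) *m s).
  rewrite mulmxBl [RHS]dotBr; move: hE; rewrite /h' => <-.
  by rewrite {2}/e !dotBr; ring.
have [->|e0] := eqVneq e 0; first by rewrite enorm0 mulr_ge0 ?enorm_ge0.
rewrite -enorm_gt0 in e0; rewrite -(ler_pM2l e0) -expr2 sqr_enorm eE.
apply: le_trans (dot_le _ _) _; rewrite ler_pM2l //; apply: jacL.
by move: t01; rewrite in_itv /= => /andP[/ltW -> /ltW ->].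
Qed.

End taylor.
(** * Convergence of the trust-region iteration *)

(** The convergence argument concerns scalar sequences only: phi is the merit,
    pred and ared are the predicted decrease and the decrease at the trial
    point, g is the norm of the gradient. *)
Section trust_region_convergence.
Context {R : realType}.
Variables (R0 zeta : R) (phi Delta pred ared : nat -> R).
Hypotheses (R0_gt0 : 0 < R0) (Delta0_itv : 0 < Delta 0%N <= R0).
Hypothesis DeltaS : forall k,
  Delta k.+1 = if ared k / pred k <= 1 / 2 then Delta k / 2
               else Num.min (2 * Delta k) R0.

Lemma radius_itv k : 0 < Delta k <= R0.
Proof.
elim: k => [//|k /andP[D0 DR]]; rewrite DeltaS; case: ifP => _.
  by apply/andP; split; lra.
by rewrite lt_min ge_min lexx orbT andbT R0_gt0 andbT; lra.
Qed.

Hypothesis zeta_itv : 0 < zeta <= 1 / 2.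
Hypothesis phiS : forall k,
  phi k.+1 = if zeta <= ared k / pred k then phi k - ared k else phi k.
Hypothesis pred_gt0 : forall k, 0 < pred k.

Lemma merit_nonincreasing k : phi k.+1 <= phi k.
Proof.
rewrite phiS; case: ifP => // acc; case/andP: zeta_itv => z0 _.
rewrite ler_pdivlMr ?pred_gt0 // in acc.
by rewrite gerBl (le_trans _ acc) // mulr_ge0 // ltW // pred_gt0.
Qed.

Lemma merit_mono k l : (k <= l)%N -> phi l <= phi k.
Proof.
move=> /subnK <-; elim: (l - k)%N => [|i IH] //.
by rewrite addSn; exact: le_trans (merit_nonincreasing _) IH.
Qed.

Variables (C K : R) (g : nat -> R).
Hypotheses (C_gt0 : 0 < C) (K_gt0 : 0 < K).
Hypothesis g_gt0 : forall k, 0 < g k.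
Hypothesis phi_ge0 : forall k, 0 <= phi k.
Hypothesis pred_ge : forall k,
  g k / 2 * Num.min (g k / C) (Delta k) <= pred k.
Hypothesis model_error : forall k, `|ared k - pred k| <= K * Delta k ^+ 2.

(** Radii are at most R0, so the minimum of eps / C and Delta k is at least a
    fixed multiple of Delta k. *)
Lemma pred_ge_radius eps k : 0 < eps -> eps <= g k ->
  eps / 2 * Num.min (eps / (C * R0)) 1 * Delta k <= pred k.
Proof.
move=> e0 eg; apply: le_trans (pred_ge k); have /andP[D0 DR] := radius_itv k.
rewrite -mulrA; apply: ler_pM; first by rewrite divr_ge0 // ltW.
- by rewrite mulr_ge0 ?(ltW D0) // le_min ler01 divr_ge0 ?mulr_ge0 // ltW.
- by rewrite ler_pM2r.
rewrite le_min; apply/andP; split; last first.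
  by rewrite -[leRHS]mul1r ler_wpM2r ?(ltW D0) // ge_min lexx orbT.
apply: (@le_trans _ _ (eps / (C * R0) * R0)).
  rewrite ler_pM ?(ltW D0) ?le_min ?ler01 ?ge_min ?lexx //.
  by rewrite divr_ge0 ?mulr_ge0 // ltW.
have -> : eps / (C * R0) * R0 = eps / C by field; rewrite !gt_eqF.
by rewrite ler_pM2r ?invr_gt0.
Qed.

Lemma accepted_decrease eps k : 0 < eps -> eps <= g k ->
  zeta <= ared k / pred k ->
  zeta * (eps / 2 * Num.min (eps / (C * R0)) 1) * Delta k <= phi k - phi k.+1.
Proof.
move=> e0 eg acc; rewrite phiS acc opprB addrC subrK.
case/andP: zeta_itv => z0 _.
rewrite ler_pdivlMr ?pred_gt0 // in acc; apply: le_trans acc.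
by rewrite -mulrA ler_pM2l // pred_ge_radius.
Qed.

(** For such a radius the model error K * Delta k ^+ 2 is less than half of
    eps / 2 * Delta k, a lower bound of the prediction, so the ratio
    exceeds 1 / 2. *)
Lemma small_radius_grows eps k : 0 < eps -> eps <= g k ->
  Delta k < eps / C -> Delta k < eps / (4 * K) -> Delta k <= Delta k.+1.
Proof.
move=> e0 eg DC DK; have /andP[D0 DR] := radius_itv k.
have pD : eps / 2 * Delta k <= pred k.
  apply: le_trans (pred_ge k); rewrite ler_pM ?divr_ge0 ?(ltW e0) ?(ltW D0) //.
    by rewrite ler_pM2r.
  rewrite le_min lexx andbT (le_trans (ltW DC)) // ler_pM2r ?invr_gt0 //.
have good : 1 / 2 < ared k / pred k.
  rewrite ltr_pdivlMr ?pred_gt0 //.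
  have := model_error k; rewrite ler_norml => /andP[err _].
  have KD : K * Delta k ^+ 2 < eps / 4 * Delta k.
    rewrite expr2 mulrA ltr_pM2r //.
    by move: DK; rewrite ltr_pdivlMr ?mulr_gt0 //; lra.
  lra.
rewrite DeltaS (leNgt (ared k / _)) good /= le_min DR andbT; lra.
Qed.

(** If g stayed above eps, the radii would stay above some d > 0, yet each
    radius that is not halved costs a decrease of phi proportional to it, and
    phi is bounded below. *)
Lemma gradient_liminf eps N : 0 < eps -> exists2 k, (N <= k)%N & g k < eps.
Proof.
move=> e0; apply: contrapT => /forall2NP noK.
have big k : (N <= k)%N -> eps <= g k.
  by move=> Nk; rewrite leNgt; apply/negP; have [] := noK k.
pose d := Num.min (Delta N) (Num.min (eps / C) (eps / (4 * K)) / 2).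
have d0 : 0 < d.
  have /andP[DN _] := radius_itv N.
  by rewrite lt_min DN divr_gt0 // lt_min !divr_gt0 // mulr_gt0.
have dle k : (N <= k)%N -> d <= Delta k.
  move=> /subnK <-; elim: (k - N)%N => [|i IH].
    by rewrite add0n ge_min lexx.
  rewrite addSn; set l := (i + N)%N in IH *.
  have [small|] := ltP (Delta l) (Num.min (eps / C) (eps / (4 * K))).
    apply: le_trans IH _; move: small; rewrite lt_min => /andP[s1 s2].
    by apply: small_radius_grows s1 s2 => //; rewrite big // leq_addl.
  move=> large; have /andP[D0 DR] := radius_itv l.
  apply: (@le_trans _ _ (Delta l / 2)).
    by rewrite ge_min; apply/orP; right; rewrite ler_pM2r.
  rewrite DeltaS; case: ifP => // _; rewrite le_min; apply/andP; split; lra.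
(* A step either halves the radius, or at most doubles it while phi falls by
   c1 * Delta k at least.  The weight 3 / (2 * c1) makes V fall by
   Delta k / 2 at least in both cases. *)
pose c1 := 1 / 2 * (eps / 2 * Num.min (eps / (C * R0)) 1).
have c1_gt0 : 0 < c1.
  by rewrite !mulr_gt0 // lt_min ltr01 divr_gt0 // mulr_gt0.
pose V k := Delta k + 3 / (2 * c1) * phi k.
have VS k : (N <= k)%N -> V k.+1 <= V k - d / 2.
  move=> Nk; have := dle _ Nk; have /andP[D0 _] := radius_itv k.
  have [bad|good] := leP (ared k / pred k) (1 / 2).
    have : 3 / (2 * c1) * phi k.+1 <= 3 / (2 * c1) * phi k.
      by rewrite ler_wpM2l ?merit_nonincreasing // divr_ge0 // mulr_ge0 // ltW.
    by rewrite /V DeltaS bad; lra.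
  have dec : c1 * Delta k <= phi k - phi k.+1.
    rewrite phiS (le_trans _ (ltW good)); last by case/andP: zeta_itv.
    rewrite opprB addrC subrK /c1 -mulrA.
    move: (good); rewrite ltr_pdivlMr ?pred_gt0 // => /ltW; apply: le_trans.
    by rewrite ler_pM2l ?divr_gt0 // pred_ge_radius // big.
  have : 3 / 2 * Delta k <= 3 / (2 * c1) * (phi k - phi k.+1).
    have -> : 3 / 2 * Delta k = 3 / (2 * c1) * (c1 * Delta k).
      by field; rewrite gt_eqF.
    by rewrite ler_pM2l // divr_gt0 // mulr_gt0.
  have : Delta k.+1 <= 2 * Delta k.
    by rewrite DeltaS (leNgt (ared k / _)) good /= ge_min lexx.
  by rewrite /V; lra.
have Vle i : V (i + N)%N <= V N - i%:R * (d / 2).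
  elim: i => [|i IH]; first by rewrite mul0r subr0.
  have := VS _ (leq_addl i N); rewrite addSn -[i.+1%:R]natr1; lra.
have V0 k : 0 <= V k.
  have /andP[D0 _] := radius_itv k.
  by rewrite addr_ge0 ?(ltW D0) // mulr_ge0 // divr_ge0 // mulr_ge0 // ltW.
have d2 : 0 < d / 2 by rewrite divr_gt0.
have := archi_boundP (divr_ge0 (V0 N) (ltW d2)).
set i := Num.bound _; rewrite ltr_pdivrMr //.
move=> hi; have : V (i + N)%N < 0 by have := Vle i; lra.
by rewrite ltNge V0.
Qed.

(** As phi converges, the iterates hardly move while g stays above eps; since g
    is Lipschitz along the iterates, it cannot pass from 2 * eps to below eps
    late in the run, and by [gradient_liminf] it does get below eps. *)
Lemma gradient_cvg0 (dist : nat -> nat -> R) (G : R) :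
  0 < G ->
  (forall k, dist k k = 0) ->
  (forall i j k, dist i k <= dist i j + dist j k) ->
  (forall k, dist k k.+1 <= if zeta <= ared k / pred k then Delta k else 0) ->
  (forall k l, g k <= g l + G * dist k l) ->
  g @ \oo --> (0 : R).
Proof.
move=> G0 dist0 distD distS gLip.
suff lim0 eps : 0 < eps -> exists N, forall k, (N <= k)%N -> g k < 2 * eps.
  apply/cvgrPdist_lt => eps e0.
  have [|N NP] := lim0 (eps / 2); first by rewrite divr_gt0.
  exists N => // k /= Nk; rewrite sub0r normrN ger0_norm ?(ltW (g_gt0 _)) //.
  by have := NP _ Nk; lra.
move=> e0.
pose c1 := zeta * (eps / 2 * Num.min (eps / (C * R0)) 1).
have c1_gt0 : 0 < c1.
  case/andP: zeta_itv => z0 _.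
  by rewrite !mulr_gt0 // lt_min ltr01 divr_gt0 // mulr_gt0.
have [N NP] : exists N, forall k l, (N <= k <= l)%N ->
    phi k - phi l < c1 * eps / G.
  apply: contrapT => noN.
  have drop N : exists2 l, (N <= l)%N & phi l <= phi N - c1 * eps / G.
    apply: contrapT => /forall2NP noK; apply: noN; exists N => k l /andP[Nk kl].
    have := merit_mono Nk.
    have [|/negP] := noK l; first by rewrite (leq_trans Nk kl).
    by rewrite -ltNge; lra.
  have drops i : exists l, phi l <= phi 0%N - i%:R * (c1 * eps / G).
    elim: i => [|i [l hl]]; first by exists 0%N; rewrite mul0r subr0.
    by have [l' _ hl'] := drop l; exists l'; rewrite -natr1; lra.
  have h0 : 0 < c1 * eps / G by rewrite divr_gt0 // mulr_gt0.
  have := archi_boundP (divr_ge0 (phi_ge0 0%N) (ltW h0)).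
  set i := Num.bound _; rewrite ltr_pdivrMr // => hi.
  have [l hl] := drops i; have : phi l < 0 by lra.
  by rewrite ltNge phi_ge0.
exists N => k Nk; rewrite ltNge; apply/negP => gk.
(* Up to the first index l where g falls below eps, the length of the walk is
   paid for by the decrease of phi. *)
have [l0 kl0 gl0] := gradient_liminf k e0.
have exl : exists l, (k <= l)%N && (g l < eps) by exists l0; rewrite kl0.
have [l /andP[kl gl] lmin] := ex_minnP exl.
have walk i : (k + i <= l)%N -> c1 * dist k (k + i)%N <= phi k - phi (k + i)%N.
  elim: i => [_|i IH il]; first by rewrite addn0 dist0 mulr0 subrr.
  rewrite addnS in il *.
  have big : eps <= g (k + i)%N.
    rewrite leNgt; apply/negP => small; have := lmin (k + i)%N.
    by rewrite leq_addr small => /(_ isT); rewrite leqNgt il.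
  have step : c1 * dist (k + i)%N (k + i).+1
      <= phi (k + i)%N - phi (k + i).+1.
    have := distS (k + i)%N; case: ifPn => [acc|_] hd.
      apply: le_trans (accepted_decrease e0 big acc).
      by rewrite ler_pM2l.
    apply: (@le_trans _ _ 0); last by rewrite subr_ge0 merit_nonincreasing.
    by rewrite pmulr_rle0.
  have := IH (ltnW il).
  have : c1 * dist k (k + i).+1
      <= c1 * (dist k (k + i)%N + dist (k + i)%N (k + i).+1).
    by rewrite ler_pM2l.
  lra.
have := walk (l - k)%N; rewrite subnKC // => /(_ (leqnn _)).
have := NP k l; rewrite Nk kl => /(_ isT).
have := gLip k l => hL.
have far : eps < G * dist k l by lra.
have -> : c1 * eps / G = c1 * (eps / G) by rewrite mulrA.
rewrite -ltr_pdivrMl // mulrC in far.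
move=> drop walked; have : c1 * (eps / G) < c1 * dist k l by rewrite ltr_pM2l.
by rewrite ltNge (le_trans walked (ltW drop)).
Qed.


End trust_region_convergence.

(** * The dogleg step *)

Section dogleg.
Context {R : realType} {d : nat}.
Implicit Types (B : 'M[R]_d) (g s v : 'cV[R]_d).

Definition quad_model B g v : R := dot g v + dot v (B^T *m B *m v) / 2.

Lemma dot_gram B v w : dot v (B^T *m B *m w) = dot (B *m v) (B *m w).
Proof. by rewrite -mulmxA dot_mulmx trmxK. Qed.

Lemma quad_modelE B g v : quad_model B g v = dot g v + enorm (B *m v) ^+ 2 / 2.
Proof. by rewrite /quad_model dot_gram sqr_enorm. Qed.

(** The quadratic model exceeds its value at the full step p by
    |B (v - p)|^2 / 2. *)
Lemma full_step_min B g v : B \in unitmx ->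
  quad_model B g (full_step B g) <= quad_model B g v.
Proof.
move=> uB; set p := full_step B g.
have Bp w : dot (B *m p) (B *m w) = - dot g w.
  rewrite /p /full_step mulmxN !mulmxA mulmxV // mul1mx dotNl.
  by rewrite -dot_mulmx mulKmx.
have := sqr_ge0 (enorm (B *m (v - p))).
rewrite !quad_modelE !sqr_enorm mulmxBr !(dotBl, dotBr) Bp (dotC _ (B *m p)).
rewrite !Bp; lra.
Qed.

(** Convexity of the model along the segment. *)
Lemma quad_model_segment B g p q (a : R) : 0 < a < 1 ->
  quad_model B g q <= quad_model B g p ->
  quad_model B g (p + a *: (q - p)) <= quad_model B g p.
Proof.
move=> /andP[a0 a1]; rewrite !quad_modelE !sqr_enorm.
rewrite mulmxDr -scalemxAr mulmxBr.
rewrite !(dotBl, dotBr, dotDl, dotDr, dotZl, dotZr).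
rewrite (dotC (B *m q) (B *m p)) => qp.
have := dotxx_ge0 (B *m q - B *m p).
rewrite !(dotBl, dotBr) (dotC (B *m q) (B *m p)).
set X := dot (B *m p) (B *m q) in qp *.
set Y := dot (B *m p) (B *m p) in qp *.
set Z := dot (B *m q) (B *m q) in qp *.
move=> D0; have : 0 <= a * (1 - a) * (Z - X - (X - Y)).
  by rewrite !mulr_ge0 // ?ltW // subr_gt0.
have : a * (dot g q + Z / 2) <= a * (dot g p + Y / 2) by rewrite ler_pM2l.
lra.
Qed.

(** For a step length a up to |g|^2 / |B g|^2 the quadratic term takes away at
    most half of the linear gain a |g|^2. *)
Lemma cauchy_step_decrease B g C Delta : B \in unitmx -> g != 0 -> 0 < C ->
  0 < Delta -> (forall v, enorm (B *m v) ^+ 2 <= C * enorm v ^+ 2) ->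
  quad_model B g (cauchy_step B g Delta)
    <= - (enorm g / 2 * Num.min (enorm g / C) Delta).
Proof.
move=> uB g0 C0 D0 BC; rewrite quad_modelE /cauchy_step dot_gram -sqr_enorm.
have ng : 0 < enorm g by rewrite enorm_gt0.
have Bg0 : B *m g != 0.
  by apply: contraNneq g0 => Bg; rewrite -(mulKmx uB g) Bg mulmx0.
have nBg : 0 < enorm (B *m g) ^+ 2 by rewrite exprn_gt0 // enorm_gt0.
set a := Num.min _ _.
have a0 : 0 < a by rewrite /a lt_min !divr_gt0 // exprn_gt0.
rewrite mulmxN enormN -scalemxAr enormZ dotNr dotZr -sqr_enorm.
rewrite (ger0_norm (ltW a0)) exprMn.
have aB : a * enorm (B *m g) ^+ 2 <= enorm g ^+ 2.
  by rewrite -ler_pdivlMr // /a ge_min lexx.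
have a_low : Num.min (enorm g / C) Delta <= a * enorm g.
  rewrite -ler_pdivrMr // /a le_min; apply/andP; split.
    apply: (@le_trans _ _ C^-1).
      by rewrite ler_pdivrMr // mulrC ge_min lexx.
    rewrite ler_pdivlMr // mulrC ler_pdivrMr // mulrC; exact: BC.
  by rewrite ler_pM2r ?invr_gt0 // ge_min lexx orbT.
have : a * (a * enorm (B *m g) ^+ 2) <= a * enorm g ^+ 2 by rewrite ler_pM2l.
have : enorm g / 2 * Num.min (enorm g / C) Delta
    <= enorm g / 2 * (a * enorm g) by rewrite ler_pM2l ?divr_gt0.
lra.
Qed.

Lemma enorm_cauchy_step_le B g Delta : 0 < Delta ->
  B \in unitmx -> g != 0 -> enorm (cauchy_step B g Delta) <= Delta.
Proof.
move=> D0 uB g0; have ng : 0 < enorm g by rewrite enorm_gt0.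
rewrite /cauchy_step enormN enormZ dot_gram -sqr_enorm ger0_norm.
  by rewrite -ler_pdivlMr // ge_min lexx orbT.
by rewrite le_min !divr_ge0 ?sqr_ge0 ?enorm_ge0 // ltW.
Qed.

Lemma dogleg_step_norm B g Delta s : 0 < Delta -> B \in unitmx -> g != 0 ->
  dogleg_step B g Delta s -> enorm s <= Delta.
Proof.
move=> D0 uB g0 [h1 h2 h3].
have [/[dup] h /h1 -> //|/[dup] big /h2 {}h2] :=
  leP (enorm (full_step B g)) Delta.
have := enorm_cauchy_step_le D0 uB g0.
rewrite le_eqVlt => /predU1P[/[dup] h /h2 ->|/(h3 big)]; first by rewrite h.
by case=> a [_ nD ->]; rewrite nD.
Qed.

Lemma dogleg_step_decrease B g C Delta s :
  0 < Delta -> B \in unitmx -> g != 0 -> 0 < C ->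
  (forall v, enorm (B *m v) ^+ 2 <= C * enorm v ^+ 2) ->
  dogleg_step B g Delta s ->
  enorm g / 2 * Num.min (enorm g / C) Delta <= - quad_model B g s.
Proof.
move=> D0 uB g0 C0 BC [h1 h2 h3].
have hC := cauchy_step_decrease uB g0 C0 D0 BC.
suff : quad_model B g s <= quad_model B g (cauchy_step B g Delta) by lra.
have [/h1 ->|big] := leP (enorm (full_step B g)) Delta.
  exact: full_step_min.
have := enorm_cauchy_step_le D0 uB g0.
rewrite le_eqVlt => /predU1P[/(h2 big) -> //|/(h3 big) [a [a01 _ ->]]].
by apply: quad_model_segment => //; exact: full_step_min.
Qed.

Lemma full_step0 B : full_step B 0 = 0.
Proof. by rewrite /full_step mulmx0 oppr0. Qed.

(** A vanishing gradient would make the full step, hence s, equal to 0. *)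
Lemma dogleg_step_neq0 B g Delta s :
  0 < Delta -> dogleg_step B g Delta s -> s != 0 -> g != 0.
Proof.
move=> D0 [h1 _ _]; apply: contraNneq => g0; rewrite g0 full_step0 in h1.
by rewrite h1 // enorm0 ltW.
Qed.

End dogleg.

(** * The merit function on the level set *)

Section merit.
Context {R : realType} {d : nat}.
Variables (F : 'cV[R]_d -> 'cV[R]_d) (z0 : 'cV[R]_d) (r c : R).
Hypotheses (dF : forall y, differentiable F y) (r_gt0 : 0 < r) (c_gt0 : 0 < c).
Hypothesis lipF : forall u v,
  enlarged_level_set F z0 r u -> enlarged_level_set F z0 r (u + v) ->
  enorm (F u - F (u + v)) <= c * enorm v /\
  forall x, enorm ((jac F u - jac F (u + v)) *m x) <= c * enorm v * enorm x.

Lemma level_enlarged z s :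
  level_set F z0 z -> enorm s < r -> enlarged_level_set F z0 r (z + s).
Proof. by move=> Sz sr; exists z => //; exists s. Qed.

Lemma level_sub_enlarged z : level_set F z0 z -> enlarged_level_set F z0 r z.
Proof.
by move=> Sz; rewrite -[z]addr0; apply: level_enlarged; rewrite ?enorm0.
Qed.

Lemma level_set_enorm_le z : level_set F z0 z -> enorm (F z) <= enorm (F z0).
Proof.
by rewrite /level_set /= ler_pM2r ?invr_gt0 // ler_sqr ?nnegrE ?enorm_ge0.
Qed.

Lemma increment_le z s : level_set F z0 z -> enorm s < r ->
  enorm (F (z + s) - F z) <= c * enorm s.
Proof.
move=> Sz sr; rewrite enormB.
by have [] := lipF (level_sub_enlarged Sz) (level_enlarged Sz sr).
Qed.

Lemma linearization_error z s : level_set F z0 z -> enorm s < r ->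
  enorm (F (z + s) - F z - jac F z *m s) <= c * enorm s ^+ 2.
Proof.
move=> Sz sr; rewrite expr2 mulrA; apply: taylor_first_order => //.
  by rewrite mulr_ge0 ?enorm_ge0 // ltW.
move=> t /andP[t0 t1] x.
have ts : enorm (t *: s) <= enorm s.
  by rewrite enormZ ger0_norm // ler_piMl ?enorm_ge0.
have [_ /(_ x)] := lipF (level_sub_enlarged Sz)
  (level_enlarged Sz (le_lt_trans ts sr)).
rewrite -opprB mulNmx enormN => /le_trans; apply.
by rewrite ler_wpM2r ?enorm_ge0 // ler_pM2l.
Qed.

(** For a vector v of length r / 2, jac F z *m v is an increment of F minus a
    linearization error, and both are controlled; the general case follows by
    scaling. *)
Lemma jac_level_bound z x : level_set F z0 z ->
  enorm (jac F z *m x) <= c * (1 + r / 2) * enorm x.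
Proof.
move=> Sz; have [->|x0] := eqVneq x 0; first by rewrite mulmx0 !enorm0 mulr0.
have nx : 0 < enorm x by rewrite enorm_gt0.
have l0 : 0 < r / 2 / enorm x by rewrite !divr_gt0.
pose v := (r / 2 / enorm x) *: x.
have nv : enorm v = r / 2.
  by rewrite enormZ gtr0_norm // divfK // gt_eqF.
have vr : enorm v < r by rewrite nv ltr_pdivrMr // ltr_pMr // ltr1n.
have : enorm (jac F z *m v) <= c * (1 + r / 2) * enorm v.
  have -> : jac F z *m v
      = (F (z + v) - F z) - (F (z + v) - F z - jac F z *m v).
    by rewrite opprB addrC subrK.
  apply: le_trans (ler_enormB _ _) _.
  have := increment_le Sz vr; have := linearization_error Sz vr.
  rewrite nv; lra.
by rewrite -scalemxAr !enormZ gtr0_norm // mulrCA ler_pM2l.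
Qed.

Lemma enorm_trmx_le (M : 'M[R]_d) a :
  (forall x, enorm (M *m x) <= a * enorm x) ->
  forall x, enorm (M^T *m x) <= a * enorm x.
Proof.
move=> Ma x; have [->|Mx0] := eqVneq (M^T *m x) 0.
  rewrite enorm0; have := Ma x; exact: le_trans (enorm_ge0 _).
rewrite -enorm_gt0 in Mx0; rewrite -(ler_pM2l Mx0) -expr2 sqr_enorm.
rewrite dot_mulmx trmxK; apply: le_trans (dot_le _ _) _.
by rewrite mulrA [_ * a]mulrC ler_wpM2r ?enorm_ge0.
Qed.

(** The gradient is a product of two Lipschitz factors, each bounded on the
    level set. *)
Lemma merit_grad_lipschitz z z' : level_set F z0 z -> level_set F z0 z' ->
  enorm (merit_grad F z) <= enorm (merit_grad F z')
    + (c * (1 + r / 2) * c + c * enorm (F z0)) * enorm (z' - z).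
Proof.
move=> Sz Sz'; have := lipF (level_sub_enlarged Sz) (v := z' - z).
rewrite addrC subrK => /(_ (level_sub_enlarged Sz')) [lF lJ].
have -> : merit_grad F z = merit_grad F z' + ((jac F z)^T *m (F z - F z')
    + (jac F z - jac F z')^T *m F z').
  have -> : (jac F z - jac F z')^T = (jac F z)^T - (jac F z')^T.
    exact: linearB.
  by rewrite /merit_grad mulmxBr mulmxBl subrKA addrC subrK.
apply: le_trans (ler_enormD _ _) _; rewrite lerD2l.
apply: le_trans (ler_enormD _ _) _; rewrite [leRHS]mulrDl; apply: lerD.
  apply: le_trans (enorm_trmx_le _ _) _.
    by move=> x; exact: jac_level_bound.
  rewrite -[leRHS]mulrA ler_wpM2l // mulr_ge0 ?(ltW c_gt0) //.
  by rewrite addr_ge0 // divr_ge0 // ltW.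
apply: le_trans (enorm_trmx_le lJ _) _.
rewrite mulrAC ler_wpM2r ?enorm_ge0 // ler_pM2l // level_set_enorm_le //.
Qed.

Lemma model_decreaseE z B s :
  model F z B 0 - model F z B s = - quad_model B (merit_grad F z) s.
Proof. by rewrite /model /quad_model dot0r dot0l; ring. Qed.

(** With y the increment of F, the change of |F|^2 / 2 is
    dot (F z) y + |y|^2 / 2; replacing y by jac F z *m s in the first term
    costs O(|s|^2), and the two quadratic terms are O(|s|^2) themselves. *)
Lemma model_error_le z B C s : level_set F z0 z -> enorm s < r ->
  enorm (B *m s) ^+ 2 <= C * enorm s ^+ 2 ->
  `|(enorm (F z) ^+ 2 / 2 - enorm (F (z + s)) ^+ 2 / 2)
    - (model F z B 0 - model F z B s)|
  <= (enorm (F z0) * c + c ^+ 2 / 2 + C / 2) * enorm s ^+ 2.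
Proof.
move=> Sz sr BC; rewrite model_decreaseE quad_modelE.
have := linearization_error Sz sr; have := increment_le Sz sr.
have -> : F (z + s) = F z + (F (z + s) - F z) by rewrite [RHS]addrC subrK.
move: (F (z + s) - F z) => y; rewrite [F z + y]addrC addrK => y_le e_le.
have ey : enorm y ^+ 2 <= c ^+ 2 * enorm s ^+ 2.
  by rewrite -exprMn ler_sqr ?nnegrE ?enorm_ge0 // mulr_ge0 ?enorm_ge0 // ltW.
have ee : `|dot (F z) (y - jac F z *m s)| <= enorm (F z0) * (c * enorm s ^+ 2).
  apply: le_trans (cauchy_schwarz _ _) _.
  by rewrite ler_pM ?enorm_ge0 ?level_set_enorm_le.
have -> : enorm (F z) ^+ 2 / 2 - enorm (y + F z) ^+ 2 / 2
    - - (dot (merit_grad F z) s + enorm (B *m s) ^+ 2 / 2)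
  = enorm (B *m s) ^+ 2 / 2 - dot (F z) (y - jac F z *m s) - enorm y ^+ 2 / 2.
  rewrite {1}/merit_grad -dot_mulmx dotBr !sqr_enorm !(dotDl, dotDr).
  by rewrite (dotC y (F z)); field.
have := sqr_ge0 (enorm (B *m s)); have := sqr_ge0 (enorm y).
move: ee; rewrite !ler_norml => /andP[e1 e2] y0 B0; apply/andP; split; lra.
Qed.

End merit.

(** The maximum over a window is attained, which turns it into an index; scaling
    removes the restriction to unit vectors. *)
Lemma uli_window {R : realType} d (u : nat -> 'cV[R]_d) : unif_lin_indep u ->
  exists (b : R) (k0 t : nat), [/\ 0 < b <= 1, (0 < t)%N &
    forall k x, (k0 <= k)%N -> exists2 j, (k < j <= k + t)%N &
      b * enorm x <= `|dot (u j) x|].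
Proof.
move=> [u1 [b [k0 [t [b0 _ hb]]]]].
have unit_win k x : (k0 <= k)%N -> enorm x = 1 ->
    exists2 j, (k < j <= k + t)%N & b <= `|dot (u j) x|.
  move=> kk0 x1; apply: contrapT => /forall2NP small.
  have := hb k x kk0 x1; rewrite leNgt => /negP; apply.
  rewrite big_nat; elim/big_ind: _ => // [v w vb wb|j kj].
    by rewrite gt_max vb wb.
  rewrite ltNge dotC; apply/negP; have [|//] := small j.
  by rewrite -ltnS kj.
have win k x : (k0 <= k)%N -> exists2 j, (k < j <= k + t)%N &
    b * enorm x <= `|dot (u j) x|.
  move=> kk0; have [->|x0] := eqVneq x 0.
    have [j kj _] := unit_win k (u 0%N) kk0 (u1 _).
    by exists j => //; rewrite enorm0 mulr0.
  have nx : 0 < enorm x by rewrite enorm_gt0.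
  have [|j kj hj] := unit_win k ((enorm x)^-1 *: x) kk0.
    by rewrite enormZ ger0_norm ?invr_ge0 ?enorm_ge0 // mulVf ?gt_eqF.
  exists j => //; move: hj; rewrite dotZr normrM
     ger0_norm ?invr_ge0 ?enorm_ge0 //.
  by rewrite ler_pdivlMl // mulrC.
exists (Num.min b 1), k0, t; split.
- by rewrite lt_min b0 ltr01 ge_min lexx orbT.
- have [j] := win k0 0 (leqnn _); rewrite lt0n => /andP[kj jt] _.
  by apply: contraTneq (leq_trans kj jt) => ->; rewrite addn0 ltnn.
- move=> k x kk0; have [j kj hj] := win k x kk0; exists j => //.
  by apply: le_trans hj; rewrite ler_wpM2r ?enorm_ge0 // ge_min lexx.
Qed.

(** * Convergence of the algorithm *)

Theorem theorem4p2 (R : realType) (n m : nat)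
    (L : 'cV[R]_n -> 'cV[R]_m -> R)
    (z0 : 'cV[R]_(n + m)) (B0 : 'M[R]_(n + m)) (R0 Delta0 zeta : R)
    (z s : nat -> 'cV[R]_(n + m)) (B : nat -> 'M[R]_(n + m))
    (Delta beta : nat -> R)
    (L_diff3 : thrice_differentiable (joint L))
    (run : J_trust_region_run (minimax_F L) z0 B0 R0 Delta0 zeta
             z s B Delta beta)
    (lipschitz : forall r : R, 0 < r -> exists gamma1 gamma2 : R,
       forall u v : 'cV[R]_(n + m),
         enlarged_level_set (minimax_F L) z0 r u ->
         enlarged_level_set (minimax_F L) z0 r (u + v) ->
         enorm (minimax_F L u - minimax_F L (u + v)) <= gamma1 * enorm v /\
         opnorm (jac (minimax_F L) u - jac (minimax_F L) (u + v))
           <= gamma2 * enorm v)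
    (saddle_exists : exists zs, minimax_F L zs = 0)
    (saddle_unit : forall zs, minimax_F L zs = 0 ->
       jac (minimax_F L) zs \in unitmx)
    (saddle_inv_bound : exists gamma : R, forall zs, minimax_F L zs = 0 ->
       opnorm (invmx (jac (minimax_F L) zs)) <= gamma)
    (steps_uli : steps_unif_lin_indep s) :
  (fun k => enorm (merit_grad (minimax_F L) (z k))) @ \oo --> (0 : R).
Proof.
set F := minimax_F L in run lipschitz steps_uli *.
have dF y : differentiable F y.
  have -> : F = fun z => Jmx R n m *m grad (joint L) z.
    by apply/funext => z'; rewrite /F minimax_F_grad.
  by apply: differentiable_mulmx; case: L_diff3.
case: run => B0sym R0_gt0 Delta0_itv zeta_itv z0E B0E Delta0E B_unit beta_itv.
move=> step_s DeltaS zS BS.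
have [s_neq0 u_uli] := steps_uli.
have [u_unit _] := u_uli.
pose phi k := enorm (F (z k)) ^+ 2 / 2.
pose pred k := model F (z k) (B k) 0 - model F (z k) (B k) (s k).
pose ared k := phi k - enorm (F (z k + s k)) ^+ 2 / 2.
pose g k := merit_grad F (z k).
have Delta_itv k : 0 < Delta k <= R0.
  by apply: (@radius_itv R R0 Delta pred ared); rewrite ?Delta0E.
have Delta_gt0 k : 0 < Delta k by case/andP: (Delta_itv k).
have g_neq0 k : g k != 0 :=
  dogleg_step_neq0 (Delta_gt0 k) (step_s k) (s_neq0 k).
have s_le k : enorm (s k) <= Delta k :=
  dogleg_step_norm (Delta_gt0 k) (B_unit k) (g_neq0 k) (step_s k).
have pred_low k C : 0 < C ->
    (forall v, enorm (B k *m v) ^+ 2 <= C * enorm v ^+ 2) ->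
    enorm (g k) / 2 * Num.min (enorm (g k) / C) (Delta k) <= pred k.
  move=> C0 BC; rewrite /pred model_decreaseE.
  exact: (dogleg_step_decrease (Delta_gt0 k) (B_unit k) (g_neq0 k) C0 BC
    (step_s k)).
have g_gt0 k : 0 < enorm (g k) by rewrite enorm_gt0.
(* A bound that depends on k is enough for the sign of the prediction; it keeps
   the iterates in the level set, where the uniform bound is then proved. *)
have pred_gt0 k : 0 < pred k.
  have [a a0 Ba] := enorm_mulmx_bound (B k).
  have C0 : 0 < a ^+ 2 + 1 by rewrite ltr_wpDl ?sqr_ge0.
  apply: lt_le_trans (pred_low k _ C0 _).
    by rewrite mulr_gt0 ?divr_gt0 // lt_min Delta_gt0 divr_gt0.
  move=> v; apply: (@le_trans _ _ (a ^+ 2 * enorm v ^+ 2)); last first.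
    by rewrite ler_wpM2r ?sqr_ge0 // lerDl.
  by rewrite -exprMn ler_sqr ?nnegrE ?mulr_ge0 ?enorm_ge0.
have zeta_half : 0 < zeta <= 1 / 2.
  case/andP: zeta_itv => -> /= /ltW /le_trans; apply.
  by rewrite -[leLHS]div1r ler_pdivrMr ?exprn_gt0 //; lra.
have phiS k :
    phi k.+1 = if zeta <= ared k / pred k then phi k - ared k else phi k.
  rewrite /phi zS; case: ifP => // acc.
  by rewrite /ared /phi subKr.
have level k : level_set F z0 (z k).
  rewrite /level_set /= -z0E.
  exact: (merit_mono zeta_half phiS pred_gt0 (leq0n k)).
(* The enlargement by R0 itself would miss the steps of length R0, which reach
   only the excluded boundary. *)
have r_gt0 : 0 < 2 * R0 by rewrite mulr_gt0.
have [g1 [g2 lip]] := lipschitz _ r_gt0.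
(* The maximum with 1 makes the constant positive. *)
pose c := Num.max 1 (Num.max g1 g2).
have c_gt0 : 0 < c by rewrite lt_max ltr01.
have lipF u v : enlarged_level_set F z0 (2 * R0) u ->
    enlarged_level_set F z0 (2 * R0) (u + v) ->
    enorm (F u - F (u + v)) <= c * enorm v /\
    forall x, enorm ((jac F u - jac F (u + v)) *m x) <= c * enorm v * enorm x.
  move=> Eu Euv; have [l1 l2] := lip u v Eu Euv; split=> [|x].
    by apply: le_trans l1 _; rewrite ler_wpM2r ?enorm_ge0 // !le_max lexx !orbT.
  apply: le_trans (enorm_mulmx_le _ _) _; rewrite ler_wpM2r ?enorm_ge0 //.
  by apply: le_trans l2 _; rewrite ler_wpM2r ?enorm_ge0 // !le_max lexx !orbT.
have s_lt k : enorm (s k) < 2 * R0.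
  have /andP[_ DR] := Delta_itv k; have := s_le k; lra.
pose A k := Jmx R n m *m B k.
have A_sym k : (A k)^T = A k.
  elim: k => [|k IH]; first by apply/J_symmetricP; rewrite B0E.
  by rewrite /A BS; exact: mul_Jmx_update_sym.
have beta_itv' k : 1 / 10 <= beta k <= 19 / 10.
  have /andP[] := beta_itv k; rewrite /beta_hat => h1 h2.
  by apply/andP; split; lra.
have [b [k0 [t [b01 t0 win]]]] := uli_window u_uli.
have [a a0 Aa] : exists2 a, 0 <= a & forall k, form_bounded (A k) a.
  have c8 : 0 <= 8 * c by rewrite mulr_ge0 // ltW.
  apply: (form_bounded_uniform c8 beta_itv' u_unit _ b01 t0 win) => k x y.
  rewrite /A BS; apply: J_update_form_le (s_neq0 k) (A_sym k) (beta_itv' k) _.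
  exact: (increment_le r_gt0 lipF (level k) (s_lt k)).
pose C := a ^+ 2 + 1.
have C_gt0 : 0 < C by rewrite ltr_wpDl ?sqr_ge0.
have BC k v : enorm (B k *m v) ^+ 2 <= C * enorm v ^+ 2.
  rewrite -(enorm_Jmx (B k *m v)) mulmxA -/(A k).
  apply: (@le_trans _ _ (a ^+ 2 * enorm v ^+ 2)); last first.
    by rewrite ler_wpM2r ?sqr_ge0 // lerDl.
  by rewrite -exprMn ler_sqr ?nnegrE ?mulr_ge0 ?enorm_ge0
    ?form_bounded_enorm_le.
pose K := enorm (F z0) * c + c ^+ 2 / 2 + C / 2.
have K_gt0 : 0 < K.
  rewrite ltr_wpDl ?divr_gt0 //.
  by rewrite addr_ge0 ?mulr_ge0 ?enorm_ge0 ?invr_ge0 ?sqr_ge0 ?ltW.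
have model_err k : `|ared k - pred k| <= K * Delta k ^+ 2.
  apply: le_trans
    (model_error_le dF r_gt0 c_gt0 lipF (level k) (s_lt k) (BC k _)) _.
  by rewrite ler_pM2l // ler_sqr ?nnegrE ?enorm_ge0 // ltW.
pose G := c * (1 + 2 * R0 / 2) * c + c * enorm (F z0).
have G_gt0 : 0 < G.
  rewrite ltr_wpDr ?mulr_gt0 ?mulr_ge0 ?enorm_ge0 ?(ltW c_gt0) //.
  by rewrite addr_gt0 ?divr_gt0.
apply: (@gradient_cvg0 R R0 zeta phi Delta pred ared R0_gt0 _ DeltaS zeta_half
  phiS pred_gt0 C K (fun k => enorm (g k)) C_gt0 K_gt0 g_gt0 _ _ model_err
  (fun k l => enorm (z l - z k)) G G_gt0).
- by rewrite Delta0E.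
- by move=> k; rewrite divr_ge0 ?sqr_ge0.
- by move=> k; exact: pred_low.
- by move=> k; rewrite subrr enorm0.
- by move=> i j k; rewrite -(subrKA (z j)) addrC ler_enormD.
- move=> k; rewrite zS; case: ifP => _; last by rewrite subrr enorm0.
  by rewrite addrAC subrr add0r.
- move=> k l; exact: (merit_grad_lipschitz dF r_gt0 c_gt0 lipF).
Qed.
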